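(* Any deformation quantization with separation of variables on a Kähler-Poisson manifold is natural. That is, if $M$ is a Kähler-Poisson manifold and $f*g=\sum_{r\ge0}\nu^rC_r(f,g)$ is a star product with separation of variables on $M$, then for every $r\ge0$ the bidifferential operator $C_r$ is of order not greater than $r$ in each argument.
   Context: A Kähler-Poisson manifold is a complex manifold $M$ with a Poisson tensor $\eta$ of type $(1,1)$; in local holomorphic coordinates $\{z^k,\bar z^l\}$, $\eta=g^{\bar lk}\bar\partial_l\wedge\partial_k$, with bracket $\{\phi,\psi\}_M=g^{\bar lk}(\bar\partial_l\phi\,\partial_k\psi-\bar\partial_l\psi\,\partial_k\phi)$, where $\partial_k=\partial/\partial z^k$, $\bar\partial_l=\partial/\partial\bar z^l$ (the tensor $\eta$ may be degenerate). Functions are complex-valued. A star product (deformation quantization) on $M$ is an associative $\nu$-linear, $\nu$-adically continuous product on $C^\infty(M)[[\nu]]$ with $f*g=\sum_{r\ge0}\nu^rC_r(f,g)$ for $f,g\in C^\infty(M)$, where $C_r$ are bidifferential operators, $C_0(f,g)=fg$, $C_1(f,g)-C_1(g,f)=\{f,g\}_M$, and the constant $1$ is the unit. It is with separation of variables if every $C_r$ differentiates its first argument only in antiholomorphic directions and its second argument only in holomorphic directions; equivalently, for any local holomorphic function $a$ and antiholomorphic function $b$, left $*$-multiplication by $a$ and right $*$-multiplication by $b$ are pointwise multiplication by $a$ and $b$. *)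

(* Defs.v *)
From mathcomp Require Import all_boot all_order all_algebra.
From mathcomp Require Import all_classical all_reals all_analysis.
From mathcomp.real_closed Require Import complex.

Set Implicit Arguments.
Unset Strict Implicit.
Unset Printing Implicit Defensive.

Import Order.TTheory GRing.Theory Num.Theory.
Import numFieldNormedType.Exports.

Local Open Scope classical_set_scope.
Local Open Scope ring_scope.
Local Open Scope complex_scope.

(** * Wirtinger calculus on C^n

    C^n is modelled by its real coordinates: the point [x : 'rV[R]_(n + n)]
    stands for [z^k = x_k + i x_(n+k)].  The library differentiates maps between
    normed spaces over [R], and [R[i]] is not one, so derivatives of
    complex-valued functions are taken on real and imaginary parts.

    All derivatives are total operators, with junk values where the limits do
    not exist; they depend only on the germ of the function at the point. *)
Section Wirtinger.
Context {R : realType} {n : nat}.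

Local Notation Cn := 'rV[R]_(n + n).
Implicit Types (f : Cn -> R[i]) (Om : set Cn) (k : 'I_n) (x : Cn).

Definition zcoord k x : R[i] := x ord0 (lshift n k) +i* x ord0 (rshift n k).

Definition re_part f : Cn -> R := fun x => complex.Re (f x).
Definition im_part f : Cn -> R := fun x => complex.Im (f x).

Definition pderiv (j : 'I_(n + n)) f : Cn -> R[i] := fun x =>
  'D_(delta_mx ord0 j) (re_part f) x +i* 'D_(delta_mx ord0 j) (im_part f) x.

Definition smooth_on Om f : Prop :=
  forall (s : seq 'I_(n + n)) x, Om x ->
    let h := foldr pderiv f s in
    [/\ {for x, continuous (re_part h)},
        {for x, continuous (im_part h)} &
        forall j, derivable (re_part h) x (delta_mx ord0 j) /\
                  derivable (im_part h) x (delta_mx ord0 j)].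

Definition wz k f : Cn -> R[i] := fun x =>
  (2%:R : R[i])^-1 * (pderiv (lshift n k) f x - 'i%C * pderiv (rshift n k) f x).

Definition wzbar k f : Cn -> R[i] := fun x =>
  (2%:R : R[i])^-1 * (pderiv (lshift n k) f x + 'i%C * pderiv (rshift n k) f x).

Definition holomorphic_on Om f : Prop :=
  smooth_on Om f /\ forall k x, Om x -> wzbar k f x = 0.

End Wirtinger.

(** * Complex manifolds *)

(* [cinv] is only meaningful on the image of [cdom]. *)
Record chart (R : realType) (n : nat) (M : topologicalType) := Chart {
  cdom : set M;
  cmap : M -> 'rV[R]_(n + n);
  cinv : 'rV[R]_(n + n) -> M }.

Section Charts.
Context {R : realType} {n : nat} {M : topologicalType}.
Implicit Types (phi psi : chart R n M) (f : M -> R[i]) (U : set M).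

Definition is_chart phi : Prop :=
  [/\ open (cdom phi),
      open (cmap phi @` cdom phi),
      forall p, cdom phi p -> cinv phi (cmap phi p) = p,
      forall p, cdom phi p -> {for p, continuous (cmap phi)} &
      forall p, cdom phi p -> {for cmap phi p, continuous (cinv phi)}].

Definition coord phi (k : 'I_n) : M -> R[i] := fun p => zcoord k (cmap phi p).

Definition holomorphic_change phi psi : Prop := forall k,
  holomorphic_on (cmap phi @` (cdom phi `&` cdom psi)) (coord psi k \o cinv phi).

Definition compatible phi psi : Prop :=
  holomorphic_change phi psi /\ holomorphic_change psi phi.

Definition smooth_in phi U f : Prop := smooth_on (cmap phi @` U) (f \o cinv phi).

(* d/dz^k and d/dzbar^k in the coordinates of [phi], meaningful on [cdom phi] *)
Definition dz phi (k : 'I_n) f : M -> R[i] := wz k (f \o cinv phi) \o cmap phi.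
Definition dzbar phi (k : 'I_n) f : M -> R[i] :=
  wzbar k (f \o cinv phi) \o cmap phi.

(* a pair (I, J) of multi-indices, with entries at most [N], standing for
   (d/dz)^I (d/dzbar)^J *)
Definition mindex (N : nat) : finType :=
  ({ffun 'I_n -> 'I_N.+1} * {ffun 'I_n -> 'I_N.+1})%type.

Definition mdeg N (a : mindex N) : nat :=
  (\sum_(k < n) a.1 k + \sum_(k < n) a.2 k)%N.

Definition mderiv phi N (a : mindex N) f : M -> R[i] :=
  foldr (fun k => iter (a.1 k) (dz phi k))
    (foldr (fun k => iter (a.2 k) (dzbar phi k)) f (enum 'I_n))
    (enum 'I_n).

Definition antiholomorphic N (a : mindex N) : bool := [forall k, a.1 k == ord0].
Definition holomorphic N (a : mindex N) : bool := [forall k, a.2 k == ord0].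

End Charts.

(* A maximal holomorphic atlas: its members are all the local holomorphic
   coordinate systems. *)
Record complexManifold (R : realType) (n : nat) (M : topologicalType) :=
  ComplexManifold {
    atlas : set (chart R n M);
    cm_hausdorff : hausdorff_space M;
    cm_second_countable : @second_countable M;
    cm_chart : forall phi, atlas phi -> is_chart phi;
    cm_cover : forall p : M, exists2 phi, atlas phi & cdom phi p;
    cm_compatible : forall phi psi, atlas phi -> atlas psi -> compatible phi psi;
    cm_maximal : forall phi, is_chart phi ->
      (forall psi, atlas psi -> compatible phi psi) -> atlas phi }.

Section Manifold.
Context {R : realType} {n : nat} {M : topologicalType}.
Variable X : complexManifold R n M.

Local Notation "'Fun'" := (M -> R[i]).
Implicit Types (phi psi : chart R n M) (f g h : Fun).

Definition smooth f : Prop :=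
  forall phi, atlas X phi -> smooth_in phi (cdom phi) f.

(** * Kähler-Poisson structures *)

Definition pbracket_in phi (eta : 'I_n -> 'I_n -> Fun) f g : Fun := fun p =>
  \sum_(l < n) \sum_(k < n) eta l k p *
    (dzbar phi l f p * dz phi k g p - dzbar phi l g p * dz phi k f p).

(* [kp_coef phi l k] is the coefficient g^(lbar k) of the tensor in the chart
   [phi], meaningful on [cdom phi]. *)
Record kahlerPoisson := KahlerPoisson {
  kp_coef : chart R n M -> 'I_n -> 'I_n -> Fun;
  kp_smooth : forall phi l k, atlas X phi ->
    smooth_in phi (cdom phi) (kp_coef phi l k);
  kp_tensor : forall phi psi, atlas X phi -> atlas X psi ->
    forall l k p, cdom phi p -> cdom psi p ->
      kp_coef psi l k p =
      \sum_(i < n) \sum_(j < n) kp_coef phi i j p *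
        dzbar phi i (fun q => (coord psi l q)^*%C) p * dz phi j (coord psi k) p;
  kp_jacobi : forall phi, atlas X phi ->
    forall f g h, smooth f -> smooth g -> smooth h ->
    forall p, cdom phi p ->
      let br := pbracket_in phi (kp_coef phi) in
      br f (br g h) p + br g (br h f) p + br h (br f g) p = 0 }.

(** * Bidifferential operators *)

(* [B] is defined on all functions but only its values on smooth ones matter. *)
Definition bidiff_near phi (p : M) (N : nat) (P Q : pred (mindex N))
    (B : Fun -> Fun -> Fun) : Prop :=
  exists (U : set M) (c : mindex N -> mindex N -> Fun),
    [/\ open U, U p, U `<=` cdom phi,
        forall a b, smooth_in phi U (c a b) &
        forall f g, smooth f -> smooth g -> forall q, U q ->
          B f g q = \sum_(a : mindex N | P a) \sum_(b : mindex N | Q b)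
                      c a b q * mderiv phi a f q * mderiv phi b g q].

Definition bidifferential (B : Fun -> Fun -> Fun) : Prop :=
  forall phi p, atlas X phi -> cdom phi p ->
    exists N, @bidiff_near phi p N xpredT xpredT B.

Definition bidiff_order_le (r : nat) (B : Fun -> Fun -> Fun) : Prop :=
  forall phi p, atlas X phi -> cdom phi p ->
    exists N, @bidiff_near phi p N (fun a => mdeg a <= r)%N
                                   (fun b => mdeg b <= r)%N B.

Definition bidiff_separated (B : Fun -> Fun -> Fun) : Prop :=
  forall phi p, atlas X phi -> cdom phi p ->
    exists N, @bidiff_near phi p N (@antiholomorphic n N) (@holomorphic n N) B.

(** * Star products *)

(* formal power series in nu with coefficients functions on [M] *)
Definition fseries := nat -> Fun.
Implicit Types F G H : fseries.

Definition fsmooth F : Prop := forall r, smooth (F r).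
Definition fconst f : fseries := fun r => if r is 0 then f else fun=> 0.
Definition fadd F G : fseries := fun r p => F r p + G r p.
(* action of the series sum_r a_r nu^r of C[[nu]] *)
Definition fscale (a : nat -> R[i]) F : fseries := fun r p =>
  \sum_(i < r.+1) a i * F (r - i)%N p.
(* congruence modulo nu^N *)
Definition feq_mod (N : nat) F G : Prop := forall r, (r < N)%N -> F r = G r.

Record is_star_product (eta : kahlerPoisson)
    (star : fseries -> fseries -> fseries) (C : nat -> Fun -> Fun -> Fun) :
    Prop := IsStarProduct {
  star_smooth : forall F G, fsmooth F -> fsmooth G -> fsmooth (star F G);
  star_assoc : forall F G H, fsmooth F -> fsmooth G -> fsmooth H ->
    star (star F G) H = star F (star G H);
  star_linearl : forall a F F' G, fsmooth F -> fsmooth F' -> fsmooth G ->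
    star (fadd (fscale a F) F') G = fadd (fscale a (star F G)) (star F' G);
  star_linearr : forall a F G G', fsmooth F -> fsmooth G -> fsmooth G' ->
    star F (fadd (fscale a G) G') = fadd (fscale a (star F G)) (star F G');
  star_continuous : forall F G, fsmooth F -> fsmooth G ->
    forall N, exists K, forall F' G', fsmooth F' -> fsmooth G' ->
      feq_mod K F F' -> feq_mod K G G' -> feq_mod N (star F G) (star F' G');
  star_expansion : forall f g, smooth f -> smooth g ->
    forall r, star (fconst f) (fconst g) r = C r f g;
  star_bidifferential : forall r, bidifferential (C r);
  star_C0 : forall f g, smooth f -> smooth g -> forall p, C 0%N f g p = f p * g p;
  star_C1 : forall f g, smooth f -> smooth g ->
    forall phi p, atlas X phi -> cdom phi p ->
      C 1%N f g p - C 1%N g f p = pbracket_in phi (kp_coef eta phi) f g p;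
  star_1l : forall F, fsmooth F -> star (fconst (fun=> 1)) F = F;
  star_1r : forall F, fsmooth F -> star F (fconst (fun=> 1)) = F }.

Definition separation_of_variables (C : nat -> Fun -> Fun -> Fun) : Prop :=
  forall r, bidiff_separated (C r).

Definition natural (C : nat -> Fun -> Fun -> Fun) : Prop :=
  forall r, bidiff_order_le r (C r).

End Manifold.

(* Main.v *)
Require Import Defs.
From mathcomp Require Import all_boot all_order all_algebra.
From mathcomp Require Import all_classical all_reals all_analysis.
From mathcomp.real_closed Require Import complex.
From mathcomp Require Import ring lra.

Set Implicit Arguments.
Unset Strict Implicit.
Unset Printing Implicit Defensive.

Import Order.TTheory GRing.Theory Num.Theory.
Import numFieldNormedType.Exports.

Local Open Scope classical_set_scope.
Local Open Scope ring_scope.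
Local Open Scope complex_scope.

(** Let [b] be a smooth function which is antiholomorphic near a point [q] and
    vanishes at [q]. Separation of variables gives, near [q], C_i(f, b h) =
    b C_i(f, h) for all [i], and in particular C_i(f, b) = b C_i(f, 1) = 0 for
    [i > 0]. Comparing the coefficients of nu^r in (f * b) * h = f * (b * h)
    at the point [q] then leaves, for [r > 0],
      C_r(f b, h)(q) = f(q) C_r(b, h)(q)
                       + sum_(0 < i < r) C_(r-i)(f, C_i(b, h))(q),
    where only operators of order less than [r] in nu act on [f], apart from the
    value f(q). By induction C_r(b_1 ... b_m, h)(q) = 0 as soon as [m > r]
    ([separated_vanish]).

    Apply this to the products of the functions zbar^k - zbar^k(q). The
    coefficient of C_r in front of (d/dzbar)^I in the first argument and
    (d/dz)^J in the second one is, up to I! J!, the value of C_r at [q] on the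
    corresponding monomials, so it vanishes when |I| > r ([separated_coef0]).
    The bound on |J| is the same statement for the opposite product, where the
    roles of holomorphic and antiholomorphic derivatives are exchanged; this is
    why derivatives, coordinates and operators are indexed by a boolean [s].

    Two analytic facts are needed to run this argument. A star product acts on
    global functions, so that the coordinates must be extended from a
    neighbourhood of [q] to [M] by means of smooth cutoff functions
    ([cutoff_coord]), which are built from exp(-1/x). And the product of two
    formal series has to be expanded in terms of the operators C_r, which follows
    from linearity and continuity in nu ([linear_series]). *)

(** * Smooth functions of one real variable that vanish on a half-line *)

Section DirectionalChain.
Context {R : realType} {V : normedModType R}.

(** The restriction of [f] to a line has the same difference quotients. *)
Lemma is_derive_line (f : V -> R) x v df :
  is_derive x v f df <-> is_derive (0 : R) 1 (fun h : R => f (h *: v + x)) df.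
Proof.
have E : (fun h : R => h^-1 *: ((f \o shift x) (h *: v) - f x)) =
  (fun h : R => h^-1 *: (((fun h : R => f (h *: v + x)) \o shift 0) (h *: 1)
     - f (0 *: v + x))).
  by apply/funext => h /=; rewrite scale0r add0r addr0 /GRing.scale /= mulr1.
split=> -[]; rewrite /derivable /derive.
  by rewrite E => d1 d2; split.
by rewrite -E => d1 d2; split.
Qed.

Lemma is_derive_comp1 (g : R -> R) (u : V -> R) x v (du dg : R) :
  is_derive x v u du -> is_derive (u x) 1 g dg ->
  is_derive x v (g \o u) (dg * du).
Proof.
move=> /is_derive_line Hu Hg; apply/is_derive_line.
set w := (fun h : R => u (h *: v + x)) in Hu *.
have w0 : w 0 = u x by rewrite /w scale0r add0r.
by rewrite -w0 in Hg; exact: is_derive1_comp.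
Qed.

End DirectionalChain.

Section FlatFunction.
Context {R : realType}.

(** Every derivative of the function equal to exp(-1/x) for x > 0 and to 0 for
    x <= 0 is a combination of the functions [flat k], so carrying the exponent
    [k] along lets smoothness be proved by a plain induction. *)
Definition flat (k : nat) (x : R) : R :=
  if 0 < x then x^-1 ^+ k * expR (- x^-1) else 0.

Lemma flat_gt0 k x : 0 < x -> 0 < flat k x.
Proof. by move=> x0; rewrite /flat x0 mulr_gt0 ?exprn_gt0 ?invr_gt0 ?expR_gt0. Qed.

Lemma flat_ge0 k x : 0 <= flat k x.
Proof.
by rewrite /flat; case: ifP => // x0; rewrite mulr_ge0 ?exprn_ge0 ?invr_ge0 ?expR_ge0// ltW.
Qed.

Lemma flat_le0 k x : x <= 0 -> flat k x = 0.
Proof. by rewrite /flat leNgt => /negbTE ->. Qed.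

(** The bound by [(k.+1)`! * `|x|], uniform near 0, is what makes the
    difference quotient of [flat k] at 0, which is [flat k.+1], tend to 0; it
    comes from the term of degree [k.+1] of the series of exp(1/x). *)
Lemma flat_bound k x : `|flat k x| <= (k.+1)`!%:R * `|x|.
Proof.
rewrite /flat; case: ifP => x0; last by rewrite normr0 mulr_ge0.
rewrite ger0_norm; last by rewrite mulr_ge0 ?exprn_ge0 ?expR_ge0 ?invr_ge0// ltW.
rewrite gtr0_norm// expRN ler_pdivrMr ?expR_gt0//.
have fp : 0 < (k.+1)`!%:R :> R by rewrite ltr0n fact_gt0.
have y0 : 0 < x^-1 by rewrite invr_gt0.
have := expR_ge1Dxn k (ltW y0); rewrite -(@ler_pM2l _ ((k.+1)`!%:R * x)) ?mulr_gt0//.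
apply: le_trans; rewrite mulrDr mulr1 exprS [leRHS]addrC.
rewrite -[leLHS]addr0 lerD ?mulr_ge0 ?(ltW x0) ?(ltW fp)//.
by rewrite le_eqVlt; apply/orP; left; apply/eqP; field; rewrite !gt_eqF.
Qed.

Lemma is_derive_flat k (x : R) :
  is_derive x 1 (flat k) (flat k.+2 x - k%:R * flat k.+1 x).
Proof.
have [x0|x0|->] := ltgtP x 0.
- rewrite !flat_le0 ?(ltW x0)// mulr0 subr0.
  apply: near_eq_is_derive (is_derive_cst (0 : R) x 1).
  by apply: filterS (lt_nbhsl x0) => y y0; rewrite flat_le0// ltW.
- apply: (@near_eq_is_derive _ _ _ (fun y : R => y^-1 ^+ k * expR (- y^-1))).
    by apply: filterS (lt_nbhsr x0) => y y0; rewrite /flat y0.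
  have xn0 : x != 0 by rewrite gt_eqF.
  have Hi : is_derive x 1 (fun y : R => y^-1) (- x ^- 2).
    have dx : derivable (id : R -> R) x 1 by exact: derivable_id.
    split; first exact: derivableV.
    by rewrite (deriveV (f := id))// derive_id /GRing.scale /= mulr1.
  have He : is_derive x 1 (fun y : R => expR (- y^-1)) (expR (- x^-1) * x ^- 2).
    apply: (@is_derive_comp1 _ _ expR (fun y : R => - y^-1)).
    by rewrite -[x ^- 2]opprK; exact: is_deriveN.
  have Hk := is_deriveX k Hi.
  have -> : (fun y : R => y^-1 ^+ k * expR (- y^-1)) =
      (fun y : R => y^-1) ^+ k * (fun y : R => expR (- y^-1)).
    by apply/funext => y; rewrite exprfctE.
  apply: (is_derive_eq (is_deriveM Hk He)).
  rewrite /flat x0 /GRing.scale /= !exprfctE {Hk}.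
  by case: k => [|k] /=; rewrite -?natr1 ?exprS; field.
- rewrite !flat_le0// mulr0 subr0.
  have L : (fun h : R => h^-1 *: ((flat k \o shift 0) (h *: 1) - flat k 0)) @ 0^' --> (0 : R).
    have -> : (fun h : R => h^-1 *: ((flat k \o shift 0) (h *: 1) - flat k 0)) = flat k.+1.
      apply/funext => h /=; rewrite [flat k 0]flat_le0// subr0 addr0 /GRing.scale /= mulr1.
      by rewrite /flat; case: ifP => _; rewrite ?mulr0// exprS mulrA.
    apply/cvgr0Pnorm_le => e e0.
    have e'0 : 0 < (k.+2)`!%:R^-1 * e by rewrite mulr_gt0 ?invr_gt0 ?ltr0n ?fact_gt0.
    apply: filterS (dnbhs0_le (V := R) e'0) => h hle.
    by apply: le_trans (flat_bound _ _) _; rewrite -ler_pdivlMl ?ltr0n ?fact_gt0.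
  split; first by apply/cvg_ex; exists 0.
  exact/cvg_lim.
Qed.

End FlatFunction.

(** * Smooth real functions on open sets of R^m *)

Section RealSmooth.
Context {R : realType} {m : nat}.
Local Notation V := 'rV[R]_m.
Local Notation e_ := (fun j : 'I_m => delta_mx ord0 j : V).
Implicit Types (f g u : V -> R) (Om : set V) (x : V).

Definition partial (j : 'I_m) f : V -> R := fun x => 'D_(e_ j) f x.

Definition regular Om f : Prop := forall x, Om x ->
  {for x, continuous f} /\ forall j, derivable f x (e_ j).

(** The grading by [k] only serves inductions: each rule of calculus expresses
    the partial derivatives of the new function by functions already known to
    be in [Ck k]. *)
Fixpoint Ck (k : nat) Om f : Prop :=
  regular Om f /\ if k is k'.+1 then forall j, Ck k' Om (partial j f) else True.

Definition Cinfty Om f : Prop := forall k, Ck k Om f.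

Lemma Ck_regular k Om f : Ck k Om f -> regular Om f.
Proof. by case: k => [|k] []. Qed.

Lemma CkW k Om f : Ck k.+1 Om f -> Ck k Om f.
Proof.
elim: k f => [|k IH] f [f0 fS]; first by split.
by split=> // j; apply: IH; exact: fS.
Qed.

Lemma CinftyP Om f :
  Cinfty Om f <-> forall s : seq 'I_m, regular Om (foldr partial f s).
Proof.
split=> [fk s|H k].
  suff /(_ 0) /Ck_regular : Cinfty Om (foldr partial f s) by [].
  elim: s => //= j s IH k; by have [_] := IH k.+1; apply.
elim: k f H => [|k IH] f H; first by split=> //; exact: (H [::]).
split; first exact: (H [::]).
by move=> j; apply: IH => s; have := H (rcons s j); rewrite foldr_rcons.
Qed.

Lemma Cinfty_regular Om f : Cinfty Om f -> regular Om f.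
Proof. by move=> /(_ 0)/Ck_regular. Qed.

Lemma Cinfty_partial Om f j : Cinfty Om f -> Cinfty Om (partial j f).
Proof. by move=> fk k; have [_] := fk k.+1; apply. Qed.

Lemma partialP Om f x j : regular Om f -> Om x -> is_derive x (e_ j) f (partial j f x).
Proof. by move=> f0 Ox; apply: derivableP; apply: (f0 x Ox).2. Qed.

Section Open.
Variable Om : set V.
Hypothesis oOm : open Om.

Lemma near_open (P : V -> Prop) x :
  Om x -> (forall y, Om y -> P y) -> \forall y \near x, P y.
Proof. by move=> Ox HP; apply: filterS (open_nbhs_nbhs (conj oOm Ox)). Qed.

Lemma regular_ext f g : (forall x, Om x -> f x = g x) -> regular Om f -> regular Om g.
Proof.
move=> fg f0 x Ox; have fgx := near_open Ox fg.
have [fc fd] := f0 x Ox; split.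
  rewrite /prop_for /continuous_at -fg//; apply: cvg_trans fc.
  exact: (@near_eq_cvg _ _ (nbhs x) _ f g fgx).
by move=> j; apply: near_eq_derivable (fd j).
Qed.

Lemma partial_ext f g j : (forall x, Om x -> f x = g x) ->
  forall x, Om x -> partial j f x = partial j g x.
Proof. by move=> fg x Ox; apply: near_eq_derive; exact: near_open. Qed.

Lemma Ck_ext k f g : (forall x, Om x -> f x = g x) -> Ck k Om f -> Ck k Om g.
Proof.
elim: k f g => [|k IH] f g fg [f0 fk]; first by split; [exact: regular_ext f0|].
split; first exact: regular_ext f0.
by move=> j; apply: IH (fk j); exact: partial_ext.
Qed.

Lemma Cinfty_ext f g :
  (forall x, Om x -> f x = g x) -> Cinfty Om f -> Cinfty Om g.
Proof. by move=> fg fk k; exact: Ck_ext (fk k). Qed.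

(** The inductive step shared by the closure properties below: it suffices to
    exhibit candidates [df] for the partial derivatives, on [Om] only. *)
Lemma CkS k f (df : 'I_m -> V -> R) :
  (forall x, Om x -> {for x, continuous f}) ->
  (forall x j, Om x -> is_derive x (e_ j) f (df j x)) ->
  (forall j, Ck k Om (df j)) -> Ck k.+1 Om f.
Proof.
move=> fc fd dk; split.
  by move=> x Ox; split; [exact: fc|move=> j; apply: ex_derive; exact: fd].
by move=> j; apply: Ck_ext (dk j) => x Ox; by case: (fd x j Ox).
Qed.

Lemma Cinfty_cst a : Cinfty Om (fun=> a).
Proof.
move=> k; elim: k a => [|k IH] a.
  split=> [x Ox|//]; split; first exact: cst_continuous.
  by move=> j; exact: derivable_cst.
apply: (@CkS _ _ (fun=> cst 0)).
- by move=> x Ox; exact: cst_continuous.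
- by move=> j; exact: (IH 0).
Qed.

Lemma CkD k f g : Ck k Om f -> Ck k Om g -> Ck k Om (fun x => f x + g x).
Proof.
elim: k f g => [|k IH] f g fk gk; have [f0 g0] := (Ck_regular fk, Ck_regular gk).
  split=> [x Ox|//]; split.
    by apply: continuousD; [exact: (f0 x Ox).1|exact: (g0 x Ox).1].
  by move=> j; apply: derivableD; [exact: (f0 x Ox).2|exact: (g0 x Ox).2].
apply: (@CkS _ _ (fun j x => partial j f x + partial j g x)).
- move=> x Ox.
  by apply: continuousD; [exact: (f0 x Ox).1|exact: (g0 x Ox).1].
- by move=> x j Ox; apply: is_deriveD; exact: partialP Ox.
- by move=> j; apply: IH; [apply: fk.2|apply: gk.2].
Qed.

Lemma CkM k f g : Ck k Om f -> Ck k Om g -> Ck k Om (fun x => f x * g x).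
Proof.
elim: k f g => [|k IH] f g fk gk; have [f0 g0] := (Ck_regular fk, Ck_regular gk).
  split=> [x Ox|//]; split.
    by apply: continuousM; [exact: (f0 x Ox).1|exact: (g0 x Ox).1].
  by move=> j; apply: derivableM; [exact: (f0 x Ox).2|exact: (g0 x Ox).2].
apply: (@CkS _ _ (fun j x => f x * partial j g x + g x * partial j f x)).
- move=> x Ox.
  by apply: continuousM; [exact: (f0 x Ox).1|exact: (g0 x Ox).1].
- by move=> x j Ox; apply: is_deriveM; exact: partialP Ox.
- by move=> j; apply: CkD; apply: IH; [exact: CkW|apply: gk.2|exact: CkW|apply: fk.2].
Qed.

Lemma CinftyD f g : Cinfty Om f -> Cinfty Om g -> Cinfty Om (fun x => f x + g x).
Proof. by move=> fk gk k; exact: CkD. Qed.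

Lemma CinftyM f g : Cinfty Om f -> Cinfty Om g -> Cinfty Om (fun x => f x * g x).
Proof. by move=> fk gk k; exact: CkM. Qed.

Lemma CinftyZ a f : Cinfty Om f -> Cinfty Om (fun x => a * f x).
Proof. by move=> fk; apply: CinftyM => //; exact: Cinfty_cst. Qed.

Lemma CinftyN f : Cinfty Om f -> Cinfty Om (fun x => - f x).
Proof.
move=> fk; apply: Cinfty_ext (CinftyZ (- 1) fk) => x _.
by rewrite mulN1r.
Qed.

Lemma CinftyB f g : Cinfty Om f -> Cinfty Om g -> Cinfty Om (fun x => f x - g x).
Proof. by move=> fk gk; apply: CinftyD => //; exact: CinftyN. Qed.

Lemma Cinfty_sum (I : finType) (f : I -> V -> R) :
  (forall i, Cinfty Om (f i)) -> Cinfty Om (fun x => \sum_i f i x).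
Proof.
move=> fk; elim: (index_enum I) => [|i s IH].
  by apply: Cinfty_ext (Cinfty_cst 0) => x _; rewrite big_nil.
by apply: Cinfty_ext (CinftyD (fk i) IH) => x _; rewrite big_cons.
Qed.

Lemma is_derive_coord (x v : V) (i : 'I_m) :
  is_derive x v (fun y : V => y ord0 i) (v ord0 i).
Proof.
apply: DeriveDef.
  by apply: diff_derivable; exact: differentiable_coord.
apply: cvg_lim => //.
have E : \forall h \near (0 : R)^', v ord0 i =
    h^-1 *: (((fun y : V => y ord0 i) \o shift x) (h *: v) - x ord0 i).
  apply: filterS (nbhs_dnbhs_neq (0 : R)) => h h0.
  by rewrite /= !mxE addrK /GRing.scale /= mulKf.
by apply: cvg_trans (near_eq_cvg E) _; exact: cvg_cst.
Qed.

Lemma Cinfty_coord i : Cinfty Om (fun x => x ord0 i).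
Proof.
case=> [|k].
  split=> [x Ox|//]; split; first exact: coord_continuous.
  by move=> j; apply: ex_derive; exact: is_derive_coord.
apply: (@CkS _ _ (fun j => cst (e_ j ord0 i))).
- by move=> x Ox; exact: coord_continuous.
- by move=> x j Ox; exact: is_derive_coord.
- by move=> j; apply: Cinfty_cst.
Qed.

(** The induction on the order has to be uniform in [k], because
    differentiating [flat k] produces [flat k.+1] and [flat k.+2]. *)
Lemma Cinfty_flat u k : Cinfty Om u -> Cinfty Om (fun x => flat k (u x)).
Proof.
have fcont l (y : R) : {for y, continuous (flat l : R -> R)}.
  apply/differentiable_continuous/derivable1_diffP.
  by have [] := is_derive_flat l y.
move=> uk q; elim: q k => [|q IH] k; have u0 := Cinfty_regular uk.
  split=> [x Ox|//]; split.
    by apply: continuous_comp; [exact: (u0 x Ox).1|exact: fcont].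
  move=> j; apply: ex_derive; apply: is_derive_comp1; last exact: is_derive_flat.
  exact: partialP Ox.
apply: (@CkS _ _ (fun j x => (flat k.+2 (u x) - k%:R * flat k.+1 (u x)) * partial j u x)).
- by move=> x Ox; apply: continuous_comp; [exact: (u0 x Ox).1|exact: fcont].
- move=> x j Ox; apply: is_derive_comp1; last exact: is_derive_flat.
  exact: partialP Ox.
- move=> j; apply: CkM; last exact: Cinfty_partial.
  apply: (@Ck_ext _ (fun x => flat k.+2 (u x) + (- k%:R) * flat k.+1 (u x))).
    by move=> x _; rewrite mulNr.
  by apply: CkD => //; apply: CkM => //; exact: Cinfty_cst.
Qed.

Lemma Cinfty_inv u : (forall x, Om x -> u x != 0) -> Cinfty Om u ->
  Cinfty Om (fun x => (u x)^-1).
Proof.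
move=> u_neq0 uk; have u0 := Cinfty_regular uk.
have vc x : Om x -> {for x, continuous (fun x => (u x)^-1)}.
  by move=> Ox; apply: continuousV; [exact: u_neq0|exact: (u0 x Ox).1].
elim=> [|q IH].
  split=> [x Ox|//]; split; first exact: vc.
  by move=> j; apply: derivableV; [exact: u_neq0|exact: (u0 x Ox).2].
apply: (@CkS _ _ (fun j x => - ((u x)^-1 * (u x)^-1 * partial j u x))) => //.
- move=> x j Ox; apply: DeriveDef.
    by apply: derivableV; [exact: u_neq0|exact: (u0 x Ox).2].
  rewrite deriveV; [|exact: u_neq0|exact: (u0 x Ox).2].
  by rewrite /GRing.scale /= mulNr expr2 invfM.
- move=> j; have := CkM (CkM IH IH) (Cinfty_partial j uk q).
  move=> /(CkM (Cinfty_cst (- 1) q)); apply: Ck_ext => x _.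
  by rewrite mulN1r.
Qed.

End Open.
End RealSmooth.

(** * Wirtinger calculus of smooth complex functions *)

Section ComplexParts.
Context {R : realType}.
Implicit Types u v : R[i].

Lemma complexE u v : complex.Re u = complex.Re v -> complex.Im u = complex.Im v ->
  u = v.
Proof. by case: u v => [a b] [c d] /= -> ->. Qed.

Lemma ReD u v : complex.Re (u + v) = complex.Re u + complex.Re v.
Proof. by case: u v => [a b] [c d]. Qed.
Lemma ImD u v : complex.Im (u + v) = complex.Im u + complex.Im v.
Proof. by case: u v => [a b] [c d]. Qed.
Lemma ReM u v : complex.Re (u * v) =
  complex.Re u * complex.Re v - complex.Im u * complex.Im v.
Proof. by case: u v => [a b] [c d]. Qed.
Lemma ImM u v : complex.Im (u * v) =
  complex.Re u * complex.Im v + complex.Im u * complex.Re v.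
Proof. by case: u v => [a b] [c d]. Qed.

End ComplexParts.

Section ComplexSmooth.
Context {R : realType} {n : nat}.
Local Notation Cn := 'rV[R]_(n + n).
Implicit Types (f g h : Cn -> R[i]) (Om : set Cn) (x : Cn).

Lemma smooth_onP Om f :
  smooth_on Om f <-> Cinfty Om (re_part f) /\ Cinfty Om (im_part f).
Proof.
have reE s : re_part (foldr pderiv f s) = foldr partial (re_part f) s.
  by elim: s => //= j s <-.
have imE s : im_part (foldr pderiv f s) = foldr partial (im_part f) s.
  by elim: s => //= j s <-.
split.
  move=> H; split; apply/CinftyP => s x Ox; have /= [cr ci d] := H s x Ox.
    by rewrite -reE; split=> [|j]; [exact: cr|have [] := d j].
  by rewrite -imE; split=> [|j]; [exact: ci|have [] := d j].
move=> [/CinftyP Hr /CinftyP Hi] s x Ox /=.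
have := Hr s x Ox; have := Hi s x Ox; rewrite -reE -imE => -[ci di] [cr dr].
by split.
Qed.

Lemma smooth_pderiv Om f j : smooth_on Om f -> smooth_on Om (pderiv j f).
Proof.
by move=> /smooth_onP[fr fi]; apply/smooth_onP; split; exact: Cinfty_partial.
Qed.

Lemma smooth_on_sub Om Om' f : Om' `<=` Om -> smooth_on Om f -> smooth_on Om' f.
Proof. by move=> sub H s x Ox; apply: H; exact: sub. Qed.

Section Open.
Variable Om : set Cn.
Hypothesis oOm : open Om.

Lemma smooth_on_ext f g :
  (forall x, Om x -> f x = g x) -> smooth_on Om f -> smooth_on Om g.
Proof.
move=> fg /smooth_onP[fr fi]; apply/smooth_onP; split.
  by apply: Cinfty_ext fr => // x Ox; rewrite /re_part fg.
by apply: Cinfty_ext fi => // x Ox; rewrite /im_part fg.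
Qed.

Lemma smooth_on_parts f : Cinfty Om (fun x => complex.Re (f x)) ->
  Cinfty Om (fun x => complex.Im (f x)) -> smooth_on Om f.
Proof. by move=> fr fi; apply/smooth_onP. Qed.

Lemma smooth_on_cst a : smooth_on Om (fun=> a).
Proof. by apply: smooth_on_parts; exact: Cinfty_cst. Qed.

Lemma smooth_onD f g :
  smooth_on Om f -> smooth_on Om g -> smooth_on Om (fun x => f x + g x).
Proof.
move=> /smooth_onP[fr fi] /smooth_onP[gr gi]; apply: smooth_on_parts.
  by apply: Cinfty_ext (CinftyD oOm fr gr) => // x _; rewrite ReD.
by apply: Cinfty_ext (CinftyD oOm fi gi) => // x _; rewrite ImD.
Qed.

Lemma smooth_onM f g :
  smooth_on Om f -> smooth_on Om g -> smooth_on Om (fun x => f x * g x).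
Proof.
move=> /smooth_onP[fr fi] /smooth_onP[gr gi]; apply: smooth_on_parts.
  apply: Cinfty_ext (CinftyB oOm (CinftyM oOm fr gr) (CinftyM oOm fi gi)) => //.
  by move=> x _; rewrite ReM.
apply: Cinfty_ext (CinftyD oOm (CinftyM oOm fr gi) (CinftyM oOm fi gr)) => //.
by move=> x _; rewrite ImM.
Qed.

Lemma smooth_onX f k : smooth_on Om f -> smooth_on Om (fun x => f x ^+ k).
Proof.
move=> fs; elim: k => [|k IH]; first exact: smooth_on_cst.
by apply: smooth_on_ext (smooth_onM fs IH) => x _; rewrite exprS.
Qed.

Lemma smooth_on_prod (I : Type) (r : seq I) (P : pred I) (F : I -> Cn -> R[i]) :
  (forall i, smooth_on Om (F i)) ->
  smooth_on Om (fun x => \prod_(i <- r | P i) F i x).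
Proof.
move=> Fs; elim: r => [|i r IH].
  by apply: smooth_on_ext (smooth_on_cst 1) => x _; rewrite big_nil.
case Pi : (P i); last by apply: smooth_on_ext IH => x _; rewrite big_cons Pi.
by apply: smooth_on_ext (smooth_onM (Fs i) IH) => x _; rewrite big_cons Pi.
Qed.

Lemma pderiv_ext f g j : (forall x, Om x -> f x = g x) ->
  forall x, Om x -> pderiv j f x = pderiv j g x.
Proof.
move=> fg x Ox; rewrite /pderiv; congr (_ +i* _).
  by apply: (partial_ext oOm) Ox => y Oy; rewrite /re_part fg.
by apply: (partial_ext oOm) Ox => y Oy; rewrite /im_part fg.
Qed.

Lemma pderiv_cst a j x : pderiv j (fun=> a) x = 0.
Proof.
rewrite /pderiv (_ : re_part _ = cst (complex.Re a))//.
by rewrite (_ : im_part _ = cst (complex.Im a))// !derive_cst.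
Qed.

Lemma pderivM f g j x : smooth_on Om f -> smooth_on Om g -> Om x ->
  pderiv j (fun y => f y * g y) x = f x * pderiv j g x + g x * pderiv j f x.
Proof.
move=> /smooth_onP[fr fi] /smooth_onP[gr gi] Ox.
have [[fr0 fi0] [gr0 gi0]] := (conj (conj (Cinfty_regular fr) (Cinfty_regular fi))
  (conj (Cinfty_regular gr) (Cinfty_regular gi))).
have [_ /(_ j) dfr] := fr0 x Ox; have [_ /(_ j) dfi] := fi0 x Ox.
have [_ /(_ j) dgr] := gr0 x Ox; have [_ /(_ j) dgi] := gi0 x Ox.
have reE : re_part (fun y => f y * g y) =
    re_part f * re_part g - im_part f * im_part g.
  by apply/funext => y; rewrite /re_part ReM.
have imE : im_part (fun y => f y * g y) =
    re_part f * im_part g + im_part f * re_part g.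
  by apply/funext => y; rewrite /im_part ImM.
have mul_ (p q : Cn -> R) : derivable p x (delta_mx ord0 j) ->
    derivable q x (delta_mx ord0 j) ->
    is_derive x (delta_mx ord0 j) (p * q) (p x * partial j q x + q x * partial j p x).
  by move=> dp dq; exact: (is_deriveM (derivableP dp) (derivableP dq)).
have [_ Hr] := is_deriveB (mul_ _ _ dfr dgr) (mul_ _ _ dfi dgi).
have [_ Hi] := is_deriveD (mul_ _ _ dfr dgi) (mul_ _ _ dfi dgr).
rewrite /pderiv reE imE Hr Hi; apply: complexE;
  by rewrite ?(ReD, ImD, ReM, ImM) /= /partial /re_part /im_part; ring.
Qed.

End Open.

(** The flag [s] is [true] for d/dz and [false] for d/dzbar. Exchanging the two
    arguments of a star product exchanges the two kinds of derivatives, so that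
    every statement is needed for both. *)
Definition wd (s : bool) (k : 'I_n) : (Cn -> R[i]) -> Cn -> R[i] :=
  if s then wz k else wzbar k.

Lemma wdE s k f x : wd s k f x = (2%:R : R[i])^-1 *
  (pderiv (lshift n k) f x - (-1) ^+ (~~ s) * 'i%C * pderiv (rshift n k) f x).
Proof. by case: s; rewrite /wd/= ?expr0 ?expr1 ?mulN1r ?mulNr ?opprK ?mul1r. Qed.

Section OpenW.
Variable Om : set Cn.
Hypothesis oOm : open Om.

Lemma smooth_wd s k f : smooth_on Om f -> smooth_on Om (wd s k f).
Proof.
move=> fs; have pl := smooth_pderiv (lshift n k) fs.
have pr := smooth_pderiv (rshift n k) fs.
have H := smooth_onM oOm (smooth_on_cst oOm (- ((-1) ^+ (~~ s) * 'i%C))) pr.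
have := smooth_onM oOm (smooth_on_cst oOm (2%:R^-1)) (smooth_onD oOm pl H).
by apply: smooth_on_ext => // x _; rewrite wdE mulNr.
Qed.

Lemma wd_ext s k f g : (forall x, Om x -> f x = g x) ->
  forall x, Om x -> wd s k f x = wd s k g x.
Proof. by move=> fg x Ox; rewrite !wdE !(pderiv_ext oOm _ fg Ox). Qed.

Lemma wdM s k f g x : smooth_on Om f -> smooth_on Om g -> Om x ->
  wd s k (fun y => f y * g y) x = f x * wd s k g x + g x * wd s k f x.
Proof.
move=> fs gs Ox; rewrite !wdE.
rewrite (pderivM (lshift n k) fs gs Ox) (pderivM (rshift n k) fs gs Ox).
by move: (2%:R^-1) (_ * 'i%C) => u v; ring.
Qed.

Lemma wd_cst s k a x : wd s k (fun=> a) x = 0.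
Proof. by rewrite wdE !pderiv_cst; ring. Qed.

Lemma wdZ s k a f x : smooth_on Om f -> Om x ->
  wd s k (fun y => a * f y) x = a * wd s k f x.
Proof.
move=> fs Ox; rewrite (wdM _ _ (smooth_on_cst oOm a) fs Ox).
by rewrite wd_cst mulr0 addr0.
Qed.

Lemma wdX s k f m x : smooth_on Om f -> Om x ->
  wd s k (fun y => f y ^+ m) x = m%:R * f x ^+ m.-1 * wd s k f x.
Proof.
move=> fs Ox; elim: m => [|m IH].
  by rewrite (@wd_ext _ _ _ (fun=> 1))// wd_cst !mul0r.
rewrite (@wd_ext _ _ _ (fun y => f y * f y ^+ m)); last 2 first.
- by move=> y _; rewrite exprS.
- by [].
rewrite (wdM _ _ fs (smooth_onX oOm m fs) Ox).
rewrite {}IH /=; case: m => [|m] /=; first by ring.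
by rewrite -[in RHS]natr1 exprS; ring.
Qed.

Lemma wd_prod0 s k (I : Type) (r : seq I) (P : pred I) (F : I -> Cn -> R[i]) x :
  (forall i, smooth_on Om (F i)) -> Om x ->
  (forall i, P i -> wd s k (F i) x = 0) ->
  wd s k (fun y => \prod_(i <- r | P i) F i y) x = 0.
Proof.
move=> Fs Ox F0; elim: r => [|i r IH].
  by rewrite (@wd_ext _ _ _ (fun=> 1)) ?wd_cst// => y _; rewrite big_nil.
case Pi : (P i); last first.
  rewrite (@wd_ext _ _ _ (fun y => \prod_(i <- r | P i) F i y))// => y _.
  by rewrite big_cons Pi.
rewrite (@wd_ext _ _ _ (fun y => F i y * \prod_(i <- r | P i) F i y))//.
  rewrite (wdM _ _ (Fs i) (smooth_on_prod oOm r P Fs) Ox) IH (F0 i Pi).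
  by rewrite !mulr0 addr0.
by move=> y _; rewrite big_cons Pi.
Qed.

Lemma smooth_iter_wd s k q f : smooth_on Om f -> smooth_on Om (iter q (wd s k) f).
Proof. by move=> fs; elim: q => [|q IH] /=; [exact: fs|exact: smooth_wd]. Qed.

Lemma iter_wd_ext s k q f g : (forall x, Om x -> f x = g x) ->
  forall x, Om x -> iter q (wd s k) f x = iter q (wd s k) g x.
Proof. by move=> fg; elim: q => //= q IH x Ox; exact: wd_ext. Qed.

End OpenW.

(** (d/dz)^a or (d/dzbar)^a, restricted to the indices listed in [r]. *)
Definition wds (s : bool) (a : 'I_n -> nat) (r : seq 'I_n) f : Cn -> R[i] :=
  foldr (fun k => iter (a k) (wd s k)) f r.

Section OpenWds.
Variable Om : set Cn.
Hypothesis oOm : open Om.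

Lemma smooth_wds s a r f : smooth_on Om f -> smooth_on Om (wds s a r f).
Proof. by move=> fs; elim: r => [|k r IH] /=; [exact: fs|exact: smooth_iter_wd]. Qed.

Lemma wds_ext s a r f g : (forall x, Om x -> f x = g x) ->
  forall x, Om x -> wds s a r f x = wds s a r g x.
Proof. by move=> fg; elim: r => //= k r IH x Ox; exact: (iter_wd_ext oOm). Qed.

(** A function annihilated by the derivatives in question behaves as a constant.
    This is how separation of variables makes multiplication by (anti)holomorphic
    functions commute with the operators [C r]. *)
Lemma wds_mull s a r f g : smooth_on Om f -> smooth_on Om g ->
  (forall k x, Om x -> wd s k f x = 0) ->
  forall x, Om x -> wds s a r (fun y => f y * g y) x = f x * wds s a r g x.
Proof.
move=> fs gs f0; elim: r => [//|k r IH] /= x Ox.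
rewrite (iter_wd_ext oOm _ _ _ IH Ox).
elim: (a k) x Ox => //= q IHq x Ox; rewrite (wd_ext oOm _ _ IHq Ox).
rewrite (wdM _ _ fs (smooth_iter_wd oOm s k q (smooth_wds s a r gs)) Ox).
by rewrite f0// mulr0 addr0.
Qed.

End OpenWds.

Lemma wds_zero s a r x : wds s a r (fun=> 0) x = 0.
Proof.
have E : wds s a r (fun=> 0) = fun=> 0.
  elim: r => //= k r ->; elim: (a k) => //= q ->.
  by apply/funext => y; rewrite wd_cst.
by rewrite E.
Qed.

Definition zs (s : bool) (k : 'I_n) (x : Cn) : R[i] :=
  if s then zcoord k x else (zcoord k x)^*%C.

Lemma zsE s k x :
  zs s k x = x ord0 (lshift n k) +i* ((-1) ^+ (~~ s) * x ord0 (rshift n k)).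
Proof. by case: s; rewrite /zs /zcoord/= ?expr0 ?expr1 ?mulN1r ?mul1r. Qed.

Lemma smooth_zs s k Om : open Om -> smooth_on Om (zs s k).
Proof.
move=> oOm; apply: smooth_on_parts.
  apply: Cinfty_ext (Cinfty_coord oOm (lshift n k)) => // x _.
  by rewrite zsE.
apply: Cinfty_ext (CinftyZ oOm ((-1) ^+ (~~ s)) (Cinfty_coord oOm (rshift n k))) => //.
by move=> x _; rewrite zsE.
Qed.

Lemma pderiv_zs s k j x : pderiv j (zs s k) x =
  (lshift n k == j)%:R +i* ((-1) ^+ (~~ s) * (rshift n k == j)%:R).
Proof.
have reE : re_part (zs s k) = (fun y => y ord0 (lshift n k)).
  by apply/funext => y; rewrite /re_part zsE.
have imE : im_part (zs s k) = (-1) ^+ (~~ s) \*o (fun y => y ord0 (rshift n k)).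
  by apply/funext => y; rewrite /im_part zsE.
have dc i : is_derive x (delta_mx ord0 j : Cn) (fun y : Cn => y ord0 i) ((i == j)%:R).
  by apply: is_derive_eq (is_derive_coord _ _ _) _; rewrite mxE eqxx.
have dl := dc (lshift n k); have dr := dc (rshift n k).
rewrite /pderiv reE imE deriveMl; last by have [] := dr.
by case: dl => _ ->; case: dr => _ ->.
Qed.

Lemma wd_zs s t k l x : wd s k (zs t l) x = ((s == t) && (k == l))%:R.
Proof.
rewrite wdE !pderiv_zs !eq_lshift !eq_rshift eq_lrshift eq_rlshift [l == k]eq_sym.
have two : (2%:R : R[i]) != 0 by rewrite pnatr_eq0.
apply: (mulfI two); rewrite mulVKf//.
by case: s; case: t; case: (k == l) => /=; apply: complexE;
  rewrite ?(ReD, ImD, ReM, ImM) /=; ring.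
Qed.

End ComplexSmooth.

(** * Derivatives of monomials in the coordinates *)

Section Monomials.
Context {R : realType} {n : nat}.
Local Notation Cn := 'rV[R]_(n + n).
Implicit Types (f g h : Cn -> R[i]) (Om : set Cn) (x : Cn).

Lemma pderivD Om f g j x : smooth_on Om f -> smooth_on Om g -> Om x ->
  pderiv j (fun y => f y + g y) x = pderiv j f x + pderiv j g x.
Proof.
move=> /smooth_onP[/Cinfty_regular fr /Cinfty_regular fi].
move=> /smooth_onP[/Cinfty_regular gr /Cinfty_regular gi] Ox.
have reE : re_part (fun y => f y + g y) = re_part f + re_part g.
  by apply/funext => y; rewrite /re_part ReD.
have imE : im_part (fun y => f y + g y) = im_part f + im_part g.
  by apply/funext => y; rewrite /im_part ImD.
have [_ Hr] := is_deriveD (partialP j fr Ox) (partialP j gr Ox).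
have [_ Hi] := is_deriveD (partialP j fi Ox) (partialP j gi Ox).
by rewrite /pderiv reE imE Hr Hi.
Qed.

Lemma wdD s k Om f g x : smooth_on Om f -> smooth_on Om g -> Om x ->
  wd s k (fun y => f y + g y) x = wd s k f x + wd s k g x.
Proof.
move=> fs gs Ox; rewrite !wdE.
rewrite (pderivD (lshift n k) fs gs Ox) (pderivD (rshift n k) fs gs Ox).
by move: (2%:R^-1) (_ * 'i%C) => u v; ring.
Qed.

Definition mono (s : bool) (c : 'I_n -> R[i]) (a : 'I_n -> nat) (x : Cn) : R[i] :=
  \prod_k (zs s k x - c k) ^+ a k.

Local Notation oT := (@openT Cn).

Lemma smooth_zs_sub s k c : smooth_on setT (fun x => zs s k x - c).
Proof.
by apply: (smooth_onD oT); [exact: (smooth_zs _ _ oT)|exact: (smooth_on_cst oT)].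
Qed.

Lemma wd_zs_sub s t k l c x :
  wd s k (fun x => zs t l x - c) x = ((s == t) && (k == l))%:R.
Proof.
rewrite (@wdD _ _ setT)//; [|exact: (smooth_zs _ _ oT)|exact: (smooth_on_cst oT)].
by rewrite wd_cst addr0 wd_zs.
Qed.

Definition lower (l : 'I_n) (q : nat) (a : 'I_n -> nat) (k : 'I_n) : nat :=
  if k == l then (a k - q)%N else a k.

Lemma smooth_mono s c a : smooth_on setT (mono s c a).
Proof.
apply: (smooth_on_prod oT) => k; apply: (smooth_onX oT).
exact: smooth_zs_sub.
Qed.

Lemma wd_mono s l c a x :
  wd s l (mono s c a) x = (a l)%:R * mono s c (lower l 1 a) x.
Proof.
pose F k (y : Cn) := (zs s k y - c k) ^+ a k.
have Fs k : smooth_on setT (F k) by apply: (smooth_onX oT); exact: smooth_zs_sub.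
have E y : mono s c a y = F l y * \prod_(k | k != l) F k y.
  by rewrite /mono (bigD1 l).
rewrite (wd_ext oT s l (fun y _ => E y) (Logic.I : setT x)).
rewrite (@wdM _ _ setT)//; last exact: (smooth_on_prod oT).
have F0 k : k != l -> wd s l (F k) x = 0.
  move=> kl; rewrite (wdX oT)//; last exact: smooth_zs_sub.
  by rewrite wd_zs_sub eqxx [l == k]eq_sym (negbTE kl) mulr0.
rewrite (wd_prod0 oT)// mulr0 add0r (wdX oT)//; last exact: smooth_zs_sub.
rewrite wd_zs_sub !eqxx mulr1 /mono [in RHS](bigD1 l)//= /lower eqxx subn1.
rewrite mulrC -mulrA; congr (_ * (_ * _)); apply: eq_bigr => k kl.
by rewrite (negbTE kl).
Qed.

Lemma iter_wd_mono s l c a q x : iter q (wd s l) (mono s c a) x =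
  (a l ^_ q)%:R * mono s c (lower l q a) x.
Proof.
elim: q x => [|q IH] x /=.
  rewrite mul1r; apply: eq_bigr => k _.
  by rewrite /lower; case: ifP; rewrite ?subn0.
rewrite (wd_ext oT s l (fun y _ => IH y) (Logic.I : setT x)).
rewrite (wdZ oT)//; last exact: smooth_mono.
rewrite wd_mono mulrA -natrM ffactnSr /lower eqxx; congr (_ * _).
apply: eq_bigr => k _; case: eqP => // ->.
by rewrite -subnDA addn1.
Qed.

Lemma wds_mono s c a a' r x : uniq r -> wds s a' r (mono s c a) x =
  (\prod_(k <- r) (a k ^_ a' k))%:R *
    mono s c (fun k => if k \in r then (a k - a' k)%N else a k) x.
Proof.
elim: r x => [|l r IH] x /=; first by rewrite big_nil mul1r.
move=> /andP[lr ur].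
have IHy y : setT y -> _ := fun=> IH y ur.
rewrite (iter_wd_ext oT s l _ IHy (Logic.I : setT x)).
set b := fun k : 'I_n => _; set C : R[i] := (\prod_(k <- r) _)%:R.
have E q y : iter q (wd s l) (fun y => C * mono s c b y) y =
    C * iter q (wd s l) (mono s c b) y.
  elim: q y => //= q IHq y.
  rewrite (wd_ext oT s l (fun y _ => IHq y) (Logic.I : setT y)).
  by rewrite (wdZ oT)//; apply: (smooth_iter_wd oT); exact: smooth_mono.
rewrite E iter_wd_mono mulrA -natrM big_cons mulnC /b (negbTE lr).
congr (_ * _); apply: eq_bigr => k _; rewrite /lower inE.
by case: eqP => [->|]//=; rewrite (negbTE lr).
Qed.

(** Monomials centred at [x] are dual to the derivatives at [x], which is how
    the coefficients of a differential operator are read off its values. *)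
Lemma wds_mono_center s c a a' x : (forall k, zs s k x = c k) ->
  wds s a' (enum 'I_n) (mono s c a) x =
  if [forall k, a' k == a k] then (\prod_k (a k)`!)%:R else 0.
Proof.
move=> xc; rewrite wds_mono ?enum_uniq// big_enum /=.
case: ifPn => [/forallP/= eqa|/forallPn/= [k ak]].
  rewrite [X in _ * X]big1 => [|k _]; last first.
    by rewrite mem_enum inE (eqP (eqa k)) subnn expr0.
  rewrite mulr1; congr _%:R; apply: eq_bigr => k _.
  by rewrite (eqP (eqa k)) ffactnn.
have [lt|le] := ltnP (a k) (a' k).
  by rewrite (bigD1 k)//= ffact_small// mul0n mul0r.
rewrite /mono [X in _ * X](bigD1 k)//= mem_enum inE xc subrr expr0n.
by rewrite subn_eq0 leqNgt ltn_neqAle ak le /= mul0r mulr0.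
Qed.

End Monomials.

(** * Smooth functions on a complex manifold extending local coordinates *)

Section Cutoff.
Context {R : realType} {m : nat}.
Local Notation V := 'rV[R]_m.
Implicit Types (x : V) (d : R).

Definition sqdist (x0 x : V) : R := \sum_j (x ord0 j - x0 ord0 j) ^+ 2.

(** A smooth step, falling from 1 to 0 while [sqdist x0] grows from [d / 2] to [d]. *)
Definition cutoff (x0 : V) d (x : V) : R :=
  flat 0 (d - sqdist x0 x) /
    (flat 0 (d - sqdist x0 x) + flat 0 (sqdist x0 x - d / 2%:R)).

Lemma cutoff_denom_gt0 d (t : R) : 0 < d ->
  0 < flat 0 (d - t) + flat 0 (t - d / 2%:R).
Proof.
move=> d0; have [td|dt] := ltP t d.
  by apply: ltr_wpDr; [exact: flat_ge0|rewrite flat_gt0// subr_gt0].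
by apply: ltr_wpDl; [exact: flat_ge0|rewrite flat_gt0//; lra].
Qed.

Lemma cutoff1 x0 d x : 0 < d -> sqdist x0 x <= d / 2%:R -> cutoff x0 d x = 1.
Proof.
move=> d0 le; rewrite /cutoff [flat 0 (_ - _ / _)]flat_le0 ?addr0; last by lra.
by rewrite divff// gt_eqF// flat_gt0//; lra.
Qed.

Lemma cutoff0 x0 d x : d <= sqdist x0 x -> cutoff x0 d x = 0.
Proof. by move=> le; rewrite /cutoff flat_le0 ?mul0r//; lra. Qed.

Lemma sqdist_coord x0 x j : (x ord0 j - x0 ord0 j) ^+ 2 <= sqdist x0 x.
Proof.
rewrite /sqdist (bigD1 j)//= lerDl sumr_ge0// => i _; exact: sqr_ge0.
Qed.

Lemma Cinfty_sqdist_comp p (Om : set 'rV[R]_p) (T : 'rV[R]_p -> V) x0 :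
  open Om -> (forall j, Cinfty Om (fun y => T y ord0 j)) ->
  Cinfty Om (fun y => sqdist x0 (T y)).
Proof.
move=> oOm TC; apply: (Cinfty_sum oOm) => j.
have TB := CinftyB oOm (TC j) (Cinfty_cst oOm (x0 ord0 j)).
by apply: Cinfty_ext (CinftyM oOm TB TB) => // y _; rewrite expr2.
Qed.

(** The composition with [T] is treated directly because [cutoff] is built by
    algebra and one-variable functions from the coordinates: this avoids the
    chain rule for functions of several variables, and is enough to change
    charts. *)
Lemma Cinfty_cutoff_comp p (Om : set 'rV[R]_p) (T : 'rV[R]_p -> V) x0 d :
  0 < d -> open Om -> (forall j, Cinfty Om (fun y => T y ord0 j)) ->
  Cinfty Om (fun y => cutoff x0 d (T y)).
Proof.
move=> d0 oOm TC; have sT := Cinfty_sqdist_comp x0 oOm TC.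
have H1 := Cinfty_flat oOm 0 (CinftyB oOm (Cinfty_cst oOm d) sT).
have H2 := Cinfty_flat oOm 0 (CinftyB oOm sT (Cinfty_cst oOm (d / 2%:R))).
apply: (CinftyM oOm H1); apply: (Cinfty_inv oOm) (CinftyD oOm H1 H2) => y _.
by rewrite gt_eqF// cutoff_denom_gt0.
Qed.

Lemma sqdist_center x0 : sqdist x0 x0 = 0.
Proof. by rewrite /sqdist big1// => j _; rewrite subrr expr0n. Qed.

Lemma near_sqdist x0 d : 0 < d -> \forall x \near x0, sqdist x0 x < d.
Proof.
move=> d0.
have C : Cinfty setT (sqdist x0).
  by apply: (@Cinfty_sqdist_comp _ _ id _ openT) => j; exact: (Cinfty_coord openT).
have [cont _] := Cinfty_regular C (Logic.I : setT x0).
by apply: (cvgr_lt _ cont); rewrite sqdist_center.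
Qed.

End Cutoff.

Section ChartFacts.
Context {R : realType} {n : nat} {M : topologicalType}.
Variable phi : chart R n M.
Hypothesis phiP : is_chart phi.
Local Notation Om := (cmap phi @` cdom phi).
Implicit Types (f g : M -> R[i]) (p q : M).

Lemma open_cdom : open (cdom phi). Proof. by have [] := phiP. Qed.

Lemma cmapK p : cdom phi p -> cinv phi (cmap phi p) = p.
Proof. by have [_ _ H _ _] := phiP; exact: H. Qed.

Lemma open_cmap U : open U -> U `<=` cdom phi -> open (cmap phi @` U).
Proof.
have [_ oOm _ _ ci] := phiP => oU sU; rewrite openE => y [p Up <-{y}].
have dp := sU _ Up.
have H1 : \forall y \near cmap phi p, Om y.
  by apply: open_nbhs_nbhs; split=> //; exists p.
have H2 : \forall y \near cmap phi p, U (cinv phi y).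
  by apply: (ci p dp); rewrite cmapK//; exact: open_nbhs_nbhs.
near=> y; have [p' dp' E] : Om y by near: y.
exists p' => //; rewrite -(cmapK dp') E; near: y; exact: H2.
Unshelve. all: end_near.
Qed.

Lemma near_cmap (P : set 'rV[R]_(n + n)) p : cdom phi p ->
  (\forall x \near cmap phi p, P x) -> \forall q \near p, P (cmap phi q).
Proof. by have [_ _ _ cm _] := phiP => dp Px; exact: (cm p dp). Qed.

Definition dch (s : bool) (k : 'I_n) f : M -> R[i] :=
  if s then dz phi k f else dzbar phi k f.

Lemma dchE s k f p : dch s k f p = wd s k (f \o cinv phi) (cmap phi p).
Proof. by case: s. Qed.

(** The operators [dz] and [dzbar] go back and forth between the manifold and
    the chart at each step; on the image of the chart the intermediate trips
    cancel. *)
Lemma dch_foldr s (a : 'I_n -> nat) r f y : Om y ->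
  foldr (fun k => iter (a k) (dch s k)) f r (cinv phi y) =
  wds s a r (f \o cinv phi) y.
Proof.
have oOm : open Om by apply: open_cmap => //; exact: open_cdom.
elim: r y => //= k r IH y Oy.
have E m z : Om z -> iter m (dch s k)
    (foldr (fun k => iter (a k) (dch s k)) f r) (cinv phi z) =
    iter m (wd s k) (wds s a r (f \o cinv phi)) z.
  elim: m z => [|m IHq] z Oz /=; first exact: IH.
  rewrite dchE -(wd_ext oOm s k IHq Oz); congr (wd s k _ _).
  by case: Oz => p dp <-; rewrite cmapK.
exact: E.
Qed.

Definition exponents N (s : bool) (a : @mindex n N) : 'I_n -> nat :=
  fun k => if s then a.1 k else a.2 k.
Definition pure N (s : bool) : pred (@mindex n N) :=
  if s then @holomorphic n N else @antiholomorphic n N.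

Lemma mderiv_pure N s (a : @mindex n N) f p : pure s a -> cdom phi p ->
  mderiv phi a f p = wds s (exponents s a) (enum 'I_n) (f \o cinv phi) (cmap phi p).
Proof.
move=> Pa dp; have Op : Om (cmap phi p) by exists p.
rewrite -(dch_foldr s _ _ _ Op) cmapK// /mderiv.
have iter0 (b : {ffun 'I_n -> 'I_N.+1}) D g r : (forall k, b k == ord0) ->
    foldr (fun k : 'I_n => iter (b k) (D k)) g r = g :> (M -> R[i]).
  by move=> b0; elim: r => //= k r ->; rewrite (eqP (b0 k)).
by case: s Pa => /forallP /= Pa; [rewrite (iter0 a.2)|rewrite (iter0 a.1)].
Qed.

Lemma mdeg_pure N s (a : @mindex n N) : pure s a ->
  mdeg a = (\sum_(k < n) exponents s a k)%N.
Proof.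
rewrite /mdeg; case: s => /forallP /= Pa.
  by rewrite [X in (_ + X)%N]big1 ?addn0// => k _; rewrite (eqP (Pa k)).
by rewrite [X in (X + _)%N]big1 ?add0n// => k _; rewrite (eqP (Pa k)).
Qed.

End ChartFacts.

Section GlobalFunctions.
Context {R : realType} {n : nat} {M : topologicalType}.
Variable X : complexManifold R n M.
Implicit Types (f g : M -> R[i]) (phi psi : chart R n M).

Lemma open_chart phi : atlas X phi -> open (cmap phi @` cdom phi).
Proof. by move=> /cm_chart []. Qed.

Lemma smooth_cst a : smooth X (fun=> a).
Proof. by move=> phi aphi; apply: smooth_on_cst; exact: open_chart. Qed.

Lemma smoothM f g : smooth X f -> smooth X g -> smooth X (fun p => f p * g p).
Proof.
move=> fs gs phi aphi.
by apply: (smooth_onM (open_chart aphi)); [exact: fs|exact: gs].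
Qed.

Lemma smooth_prod (I : Type) (l : seq I) (B : I -> M -> R[i]) :
  (forall i, smooth X (B i)) -> smooth X (fun p => \prod_(i <- l) B i p).
Proof.
move=> Bs phi aphi.
have := smooth_on_prod (open_chart aphi) l xpredT (fun i => Bs i phi aphi).
exact.
Qed.

(** Local coordinates are not functions on [M], whereas a star product is only
    applied to global functions: a cutoff provides a global function with
    the germ at [q] of a centred coordinate. Near a point outside the chart the cutoff function
    vanishes because the image of a closed box of the chart is compact, hence
    closed in the Hausdorff space [M]. *)
Lemma cutoff_coord phi q s k : atlas X phi -> cdom phi q ->
  exists2 b, smooth X b & \forall p \near q,
    cdom phi p /\ b p = zs s k (cmap phi p) - zs s k (cmap phi q).
Proof.
move=> aphi dq; have phiP := cm_chart aphi.
have [odom oOm _ _ cinvc] := phiP.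
set x0 := cmap phi q.
have [e /= e0 eOm] : nbhs_ball x0 (cmap phi @` cdom phi).
  by apply/nbhs_ballP; apply: open_nbhs_nbhs; split=> //; exists q.
pose d := e / 2%:R; have d0 : 0 < d by rewrite divr_gt0.
have de : e = d + d by rewrite /d; field.
pose D := d ^+ 2; have D0 : 0 < D by rewrite exprn_gt0.
pose box : set 'rV[R]_(n + n) :=
  [set x | forall j, `[x0 ord0 j - d, x0 ord0 j + d]%classic (x ord0 j)].
have boxOm : box `<=` cmap phi @` cdom phi.
  move=> x xb; apply: eOm; split=> // i j; rewrite (ord1 i) /ball /=.
  have := xb j; rewrite /= in_itv /= => /andP[l u].
  by rewrite ltr_norml de; apply/andP; split; move: l u d0; clear; lra.
have box_compact : compact box.
  apply: (@rV_compact R (n + n) (fun j => `[x0 ord0 j - d, x0 ord0 j + d]%classic)).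
  by move=> j; exact: segment_compact.
(* [b] is supported in [K]. *)
pose K := cinv phi @` box.
have K_closed : closed K.
  apply: compact_closed; first exact: cm_hausdorff X.
  apply: continuous_compact => //; apply: continuous_in_subspaceT => x.
  by rewrite inE => /boxOm[p dp <-]; exact: cinvc.
pose c := zs s k x0.
pose b p : R[i] := if `[< cdom phi p >] then
  (cutoff x0 D (cmap phi p) +i* 0) * (zs s k (cmap phi p) - c) else 0.
exists b; last first.
  have D20 : 0 < D / 2%:R by rewrite divr_gt0.
  have H1 := near_cmap phiP dq (near_sqdist x0 D20).
  have H2 : \forall p \near q, cdom phi p by apply: open_nbhs_nbhs.
  apply: filterS2 H1 H2 => p lt dp; split=> //.
  rewrite /b asboolT// cutoff1 ?(ltW lt)//.
  by have -> : (1 +i* 0 = 1 :> R[i])%C by []; rewrite mul1r.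
move=> psi apsi; have psiP := cm_chart apsi.
have [opsi _ _ _ _] := psiP.
pose O1 := cmap psi @` (cdom psi `&` cdom phi).
pose O2 := cmap psi @` (cdom psi `\` K).
have oO1 : open O1 by apply: (open_cmap psiP) => [|p []//]; exact: openI.
have oO2 : open O2.
  apply: (open_cmap psiP) => [|p []//].
  by apply: openI => //; exact: closed_openC.
(* In another chart [psi], the domain is covered by [O1] and [O2]. *)
have S1 : smooth_on O1 (b \o cinv psi).
  pose T y := cmap phi (cinv psi y).
  have [_ chol] := cm_compatible aphi apsi.
  have TC j : Cinfty O1 (fun y => T y ord0 j).
    case: (fintype.split_ordP j) => i ->.
      by have [/smooth_onP[H _] _] := chol i.
    by have [/smooth_onP[_ H] _] := chol i.
  have zT : smooth_on O1 (fun y => zs s k (T y)).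
    apply: smooth_on_parts.
      by apply: Cinfty_ext (TC (lshift n k)) => // y _; rewrite zsE.
    apply: Cinfty_ext (CinftyZ oO1 ((-1) ^+ (~~ s)) (TC (rshift n k))) => //.
    by move=> y _; rewrite zsE.
  have bT : smooth_on O1 (fun y => cutoff x0 D (T y) +i* 0).
    by apply: smooth_on_parts; [exact: Cinfty_cutoff_comp|exact: Cinfty_cst].
  have := smooth_onM oO1 bT (smooth_onD oO1 zT (smooth_on_cst oO1 (- c))).
  apply: smooth_on_ext => // y [p [dp dp'] <-].
  by rewrite /b /= /T (cmapK psiP)// asboolT.
have S2 : smooth_on O2 (b \o cinv psi).
  apply: smooth_on_ext (smooth_on_cst oO2 0) => // y [p [dp nK] <-] /=.
  rewrite (cmapK psiP)// /b; case: asboolP => // dp'.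
  have [xb|] := pselect (box (cmap phi p)).
    by case: nK; exists (cmap phi p) => //; exact: cmapK.
  move=> /existsNP[j nj]; rewrite cutoff0; last first.
    apply: le_trans (sqdist_coord x0 (cmap phi p) j).
    rewrite -[leRHS]real_normK ?num_real// ler_pXn2r ?nnegrE ?(ltW d0)//.
    rewrite leNgt ltr_norml; apply/negP => /andP[l u]; apply: nj.
    by rewrite /= in_itv /=; apply/andP; split; lra.
  by have -> : (0 +i* 0 = 0 :> R[i])%C by []; rewrite mul0r.
move=> r y [p dp <-]; have [dp'|ndp'] := pselect (cdom phi p).
  by apply: S1; exists p.
apply: S2; exists p => //; split=> // -[x /boxOm[p' dp'' <-]].
by rewrite (cmapK phiP)// => E; apply: ndp'; rewrite -E.
Qed.

End GlobalFunctions.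

(** * Operators with separated variables *)

Section Separated.
Context {R : realType} {n : nat} {M : topologicalType}.
Variable X : complexManifold R n M.
Local Notation Fun := (M -> R[i]).
Implicit Types (f g h : Fun) (phi psi : chart R n M).

(** The second argument is differentiated by derivatives of type [s] only, and
    the first one by those of the opposite type: [s = true] for the operators of
    a star product with separation of variables, [s = false] for those of the
    opposite product. *)
Definition separated (s : bool) (B : Fun -> Fun -> Fun) : Prop :=
  forall phi p, atlas X phi -> cdom phi p ->
    exists N, bidiff_near X phi p (@pure n N (~~ s)) (@pure n N s) B.

Definition annihilated (s : bool) phi (V : set 'rV[R]_(n + n)) f : Prop :=
  forall k x, V x -> wd s k (f \o cinv phi) x = 0.

Lemma open_near_cmap phi p (P : M -> Prop) : atlas X phi -> cdom phi p ->
  (\forall q \near p, P q) -> exists2 V : set 'rV[R]_(n + n),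
    open V /\ V (cmap phi p) &
    forall x, V x -> exists2 q, cdom phi q /\ cmap phi q = x & P q.
Proof.
move=> aphi dp; rewrite /prop_near1 nbhsE => -[W [oW Wp] WP].
have phiP := cm_chart aphi; exists (cmap phi @` (cdom phi `&` W)).
  split; last by exists p.
  by apply: (open_cmap phiP) => [|q []//]; apply: openI => //; exact: open_cdom.
by move=> x [q [dq Wq] <-]; exists q => //; exact: WP.
Qed.

Lemma separated_local s B f g p : separated s B -> smooth X f -> smooth X g ->
  (\forall q \near p, f q = 0) -> B f g p = 0.
Proof.
move=> sB fs gs f0; have [phi aphi dp] := cm_cover X p.
have [N [U [c [oU Up UD cs HB]]]] := sB phi p aphi dp.
have phiP := cm_chart aphi.
have [V [oV Vp] HV] := open_near_cmap aphi dp f0.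
rewrite HB//; apply: big1 => a Pa; apply: big1 => b Pb.
rewrite (mderiv_pure phiP _ Pa dp).
rewrite (@wds_ext _ _ V oV _ _ _ _ (fun=> 0)) ?wds_zero ?mulr0 ?mul0r//.
by move=> x /HV[q [dq <-] fq]; rewrite /= (cmapK phiP).
Qed.

Lemma separated_mul s B b f g phi V p : separated s B -> atlas X phi ->
  smooth X b -> smooth X f -> smooth X g -> open V -> annihilated s phi V b ->
  cdom phi p -> V (cmap phi p) ->
  B f (fun q => b q * g q) p = b p * B f g p.
Proof.
move=> sB aphi bs fs gs oV bV dp Vp.
have [N [U [c [oU Up UD cs HB]]]] := sB phi p aphi dp.
have phiP := cm_chart aphi.
pose V' := V `&` (cmap phi @` cdom phi).
have oV' : open V' by apply: openI => //; exact: open_chart aphi.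
have Vp' : V' (cmap phi p) by split=> //; exists p.
have sub h : smooth X h -> smooth_on V' (h \o cinv phi).
  by move=> hs; apply: smooth_on_sub (hs phi aphi) => x [].
rewrite (HB _ _ fs (smoothM bs gs) _ Up).
rewrite (HB f g fs gs p Up) big_distrr; apply: eq_bigr => a Pa.
rewrite big_distrr; apply: eq_bigr => a' Pa' /=.
rewrite !(mderiv_pure phiP _ Pa' dp).
have := @wds_mull _ _ V' oV' s (exponents s a') (enum 'I_n) (b \o cinv phi)
  (g \o cinv phi) (sub b bs) (sub g gs) (fun k x Vx => bV k x Vx.1) _ Vp'.
rewrite /= (cmapK phiP dp) => ->.
by ring.
Qed.

(** What the induction on the order uses of a star product. These properties
    are symmetric: the opposite product has them with [~~ s] in place of [s]. *)
Record separated_associative (s : bool) (C : nat -> Fun -> Fun -> Fun) : Prop :=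
  SeparatedAssociative {
  sa_smooth : forall r f g, smooth X f -> smooth X g -> smooth X (C r f g);
  sa_separated : forall r, separated s (C r);
  sa_C0 : forall f g, smooth X f -> smooth X g -> C 0%N f g = fun p => f p * g p;
  sa_unit : forall r f, smooth X f -> C r.+1 f (fun=> 1) = fun=> 0;
  sa_assoc : forall r f g h, smooth X f -> smooth X g -> smooth X h -> forall p,
    \sum_(i < r.+1) C (r - i)%N (C i f g) h p =
    \sum_(i < r.+1) C (r - i)%N f (C i g h) p }.

(** Let [b] be one of the factors [B i] and [f] the product of the other ones.
    In the associativity of [f], [b], [h] at order [r], taken at [p],
    the terms with [C i f b], [i > 0], vanish since [C i f b = b * C i f 1 = 0]
    near [p], and the term [C r f (b * h)] vanishes since it equals
    [b p * C r f h p]. The remaining terms [C (r - i) f (C i b h)] with [i > 0]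
    have one factor less, and an order smaller by at least one. *)
Lemma separated_vanish s C (I : Type) (B : I -> Fun) (l : seq I) phi V p :
  separated_associative s C -> atlas X phi -> cdom phi p ->
  open V -> V (cmap phi p) ->
  (forall i, smooth X (B i)) -> (forall i, annihilated s phi V (B i)) ->
  (forall i, B i p = 0) ->
  forall r h, (r < size l)%N -> smooth X h ->
  C r (fun q => \prod_(i <- l) B i q) h p = 0.
Proof.
move=> CP aphi dp oV Vp Bs BV B0; elim: l => // i l IH r h /= rl hs.
have phiP := cm_chart aphi.
pose f q := \prod_(j <- l) B j q.
have fs : smooth X f by exact: smooth_prod.
have E : (fun q => \prod_(j <- i :: l) B j q) = C 0%N f (B i).
  by rewrite (sa_C0 CP fs (Bs i)); apply/funext => q; rewrite big_cons mulrC.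
rewrite {}E.
case: r rl => [|r] rl.
  rewrite (sa_C0 CP fs (Bs i)) (sa_C0 CP (smoothM fs (Bs i)) hs) /=.
  by rewrite B0 mulr0 mul0r.
have := sa_assoc CP r.+1 fs (Bs i) hs p.
rewrite big_ord_recl subn0 big1 ?addr0 => [->|j _]; last first.
  apply: (separated_local (sa_separated CP _) (sa_smooth CP _ fs (Bs i)) hs).
  have H1 := near_cmap phiP dp (open_nbhs_nbhs (conj oV Vp)).
  have H2 : \forall q \near p, cdom phi q.
    by apply: open_nbhs_nbhs; split=> //; exact: open_cdom.
  apply: filterS2 H1 H2 => q Vq dq.
  have -> : B i = fun q => B i q * 1 by apply/funext => q'; rewrite mulr1.
  rewrite (separated_mul (sa_separated CP _) aphi (Bs i) fs _ oV (BV i) dq Vq).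
    by rewrite lift0 (sa_unit CP)// mulr0.
  exact: smooth_cst.
rewrite big_ord_recl subn0 big1 ?addr0 => [|j _]; last first.
  apply: IH (sa_smooth CP _ (Bs i) hs).
  by rewrite lift0 subSS; apply: leq_ltn_trans (leq_subr _ _) _.
rewrite (sa_C0 CP (Bs i) hs) (separated_mul (sa_separated CP _) aphi (Bs i) fs hs oV (BV i) dp Vp).
by rewrite B0 mul0r.
Qed.

(** Up to factorials, [c a b p] is the value at [p] of [C r] on two monomials
    centred at [p]; the first one has more than [r] factors. *)
Lemma separated_coef0 s C r phi N (U : set M)
    (c : @mindex n N -> @mindex n N -> Fun) (a b : @mindex n N) p :
  separated_associative s C -> atlas X phi -> U `<=` cdom phi ->
  (forall f g, smooth X f -> smooth X g -> forall q, U q ->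
    C r f g q = \sum_(a | pure (~~ s) a) \sum_(b | pure s b)
      c a b q * mderiv phi a f q * mderiv phi b g q) ->
  pure (~~ s) a -> pure s b -> (r < mdeg a)%N -> U p -> c a b p = 0.
Proof.
move=> CP aphi UD HC Pa Pb ra Up; have dp := UD _ Up.
have phiP := cm_chart aphi.
have /choice[F HF] : forall t : bool * 'I_n, exists f, smooth X f /\
    \forall q \near p, cdom phi q /\
      f q = zs t.1 t.2 (cmap phi q) - zs t.1 t.2 (cmap phi p).
  by move=> [t k]; have [f fs fE] := cutoff_coord t k aphi dp; exists f.
pose x0 := cmap phi p.
pose z0 t k := zs t k x0.
(* All the [F t] coincide with centred coordinates on one common open set. *)
have [V [oV Vp] HV] : exists2 V : set 'rV[R]_(n + n), open V /\ V x0 &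
    forall x, V x -> exists2 q, cdom phi q /\ cmap phi q = x &
      forall t, F t q = zs t.1 t.2 (cmap phi q) - z0 t.1 t.2.
  apply: (open_near_cmap aphi dp); apply: filter_forall => t.
  by apply: filterS (HF t).2 => q [].
have FV t x : V x -> F t (cinv phi x) = zs t.1 t.2 x - z0 t.1 t.2.
  by move=> /HV[q [dq <-] fq]; rewrite (cmapK phiP).
pose l (t : bool) (e : 'I_n -> nat) := flatten [seq nseq (e k) k | k <- enum 'I_n].
pose G t (e : 'I_n -> nat) q := \prod_(k <- l t e) F (t, k) q.
have Gs t e : smooth X (G t e) by apply: smooth_prod => k; exact: (HF (t, k)).1.
have GV t e x : V x -> (G t e \o cinv phi) x = mono t (z0 t) e x.
  move=> Vx; rewrite /G /l /= big_flatten /= big_map big_enum /=.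
  apply: eq_bigr => k _; rewrite big_nseq iter_mulr_1.
  by rewrite FV.
have GD t e (d : @mindex n N) : pure t d ->
    mderiv phi d (G t e) p =
    if [forall k, exponents t d k == e k] then (\prod_k (e k)`!)%:R else 0.
  move=> Pd; rewrite (mderiv_pure phiP _ Pd dp).
  rewrite (wds_ext oV _ _ _ (fun x Vx => GV t e x Vx) Vp).
  exact: wds_mono_center.
have exponents_inj t (d d' : @mindex n N) : pure t d -> pure t d' ->
    [forall k, exponents t d k == exponents t d' k] = (d == d').
  move=> Pd Pd'; apply/forallP/eqP => [|->]// dd'.
  case: d d' Pd Pd' dd' => [d1 d2] [d1' d2'].
  case: t => /forallP /= Pd /forallP /= Pd' dd'; congr (_, _); apply/ffunP => k.
  - exact/val_inj/eqP/dd'.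
  - by rewrite (eqP (Pd k)) (eqP (Pd' k)).
  - by rewrite (eqP (Pd k)) (eqP (Pd' k)).
  - exact/val_inj/eqP/dd'.
(* [separated_vanish] applies since the coordinates of type [~~ s] are
   annihilated by the derivatives of type [s]. *)
have H : C r (G (~~ s) (exponents (~~ s) a)) (G s (exponents s b)) p = 0.
  apply: (@separated_vanish s C _ (fun k => F (~~ s, k)) _ phi V p) => //.
  - by move=> k; exact: (HF (~~ s, k)).1.
  - move=> k j x Vx.
    rewrite (wd_ext oV s j (fun y Vy => FV (~~ s, k) y Vy) Vx) wd_zs_sub.
    by case: (s).
  - by move=> k; rewrite -(cmapK phiP dp) FV// subrr.
  - rewrite size_flatten /shape -map_comp sumnE big_map big_enum /=.
    rewrite (eq_bigr (exponents (~~ s) a)) -?(mdeg_pure Pa)// => k _.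
    by rewrite size_nseq.
move: H; rewrite HC// (bigD1 a)//= [X in _ + X]big1 ?addr0; last first.
  move=> d /andP[Pd da]; apply: big1 => d' Pd'.
  by rewrite GD// exponents_inj// (negbTE da) mulr0 mul0r.
rewrite (bigD1 b)//= [X in _ + X]big1 ?addr0; last first.
  by move=> d /andP[Pd db]; rewrite [mderiv _ d _ _]GD// exponents_inj// (negbTE db) mulr0.
rewrite !GD// !exponents_inj// !eqxx => /eqP.
have fact_neq0 e : (\prod_(k < n) (e k)`!)%:R != 0 :> R[i].
  rewrite pnatr_eq0 -lt0n prodn_gt0// => k; exact: fact_gt0.
by rewrite !mulf_eq0 !(negbTE (fact_neq0 _)) !orbF => /eqP.
Qed.

End Separated.

(** * Coefficients of a star product with separation of variables *)

Section Series.
Context {R : realType} {n : nat} {M : topologicalType}.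
Variable X : complexManifold R n M.
Local Notation Fun := (M -> R[i]).
Local Notation fseries := (nat -> Fun).
Implicit Types (f g h : Fun) (F G : fseries).

Definition nu_pow (i : nat) : nat -> R[i] := fun j => (j == i)%:R.

Definition truncate (k : nat) F : fseries := fun r => if (r < k)%N then F r else fun=> 0.

Lemma fscale_nu_pow i F r p :
  fscale (nu_pow i) F r p = if (i <= r)%N then F (r - i)%N p else 0.
Proof.
rewrite /fscale /nu_pow; case: leqP => ir.
  rewrite (bigD1 (Ordinal (ir : (i < r.+1)%N)))//= eqxx mul1r big1 ?addr0// => j.
  by rewrite -val_eqE /= => /negbTE ->; rewrite mul0r.
apply: big1 => j _; case: eqP => [ji|]; last by rewrite mul0r.
by have := ltn_ord j; rewrite ltnS ji leqNgt ir.
Qed.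

Lemma fsmooth_fconst f : smooth X f -> fsmooth X (fconst f).
Proof. by move=> fs [|r]; [exact: fs|exact: smooth_cst]. Qed.

Lemma fsmooth_truncate k F : fsmooth X F -> fsmooth X (truncate k F).
Proof. by move=> Fs r; rewrite /truncate; case: ifP => _; [exact: Fs|exact: smooth_cst]. Qed.

Lemma truncateS k F :
  truncate k.+1 F = fadd (fscale (nu_pow k) (fconst (F k))) (truncate k F).
Proof.
apply/funext => r; apply/funext => p; rewrite /fadd fscale_nu_pow /truncate ltnS.
case: (ltngtP r k) => [rk|kr|->]; first by rewrite add0r.
  by rewrite addr0; case: (r - k)%N (subn_gt0 k r) => //; rewrite kr.
by rewrite subnn addr0.
Qed.

(** A [nu]-linear operator commutes with finite sums of the form
    [F 0 + nu F 1 + ... + nu^k F k], and by continuity the coefficient of [nu^r]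
    of [L F] only depends on such a truncation of [F]. *)
Lemma linear_series (L : fseries -> fseries) F r p :
  (forall a G G', fsmooth X G -> fsmooth X G' ->
    L (fadd (fscale a G) G') = fadd (fscale a (L G)) (L G')) ->
  (forall N, exists K, forall F', fsmooth X F' -> feq_mod K F F' ->
    feq_mod N (L F) (L F')) ->
  fsmooth X F ->
  L F r p = \sum_(i < r.+1) L (fconst (F i)) (r - i)%N p.
Proof.
move=> Llin Lcont Fs.
have L0 q t : L (fun _ _ => 0) t q = 0.
  pose Z : fseries := fun _ _ => 0.
  have Zs : fsmooth X Z by move=> ?; exact: smooth_cst.
  (* Linearity at 1 * Z + Z = Z reads [L Z + L Z = L Z]. *)
  have E0 : fadd (fscale (nu_pow 0) Z) Z = Z.
    by apply/funext => u; apply/funext => v; rewrite /fadd fscale_nu_pow addr0.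
  have := Llin (nu_pow 0) Z Z Zs Zs; rewrite E0.
  move=> /(congr1 (fun G => G t q)); rewrite /fadd fscale_nu_pow /= subn0 => E.
  by apply/eqP; rewrite -(inj_eq (addrI (L Z t q))) addr0 -E.
have LT k : L (truncate k F) r p =
    \sum_(i < k | (i < r.+1)%N) L (fconst (F i)) (r - i)%N p.
  elim: k => [|k IH]; first by rewrite big_ord0 -[RHS](L0 p r).
  rewrite truncateS Llin; [|exact: fsmooth_fconst|exact: fsmooth_truncate].
  rewrite /fadd fscale_nu_pow IH big_mkcond [in RHS]big_mkcond big_ord_recr /= addrC.
  by rewrite ltnS.
have [K HK] := Lcont r.+1.
pose k := maxn K r.+1.
have FT : feq_mod K F (truncate k F).
  by move=> i iK; rewrite /truncate ifT// leq_max iK.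
rewrite (HK _ (fsmooth_truncate k Fs) FT r (ltnSn r)) LT.
by rewrite -(big_ord_widen _ (fun i => L (fconst (F i)) (r - i)%N p))// leq_maxr.
Qed.

End Series.

Section StarProduct.
Context {R : realType} {n : nat} {M : topologicalType}.
Variables (X : complexManifold R n M) (eta : kahlerPoisson X).
Local Notation Fun := (M -> R[i]).
Variables (star : (nat -> Fun) -> (nat -> Fun) -> (nat -> Fun)).
Variable (C : nat -> Fun -> Fun -> Fun).
Hypothesis starP : is_star_product eta star C.
Hypothesis sepC : separation_of_variables X C.
Implicit Types f g h : Fun.

Lemma star_seriesl F h r p : fsmooth X F -> smooth X h ->
  star F (fconst h) r p = \sum_(i < r.+1) C (r - i)%N (F i) h p.
Proof.
move=> Fs hs; have hs' := fsmooth_fconst hs.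
rewrite (@linear_series _ _ _ X (fun F => star F (fconst h)))//.
- by apply: eq_bigr => i _; rewrite (star_expansion starP (Fs i) hs).
- by move=> a G G' Gs Gs'; rewrite (star_linearl starP).
- move=> N; have [K HK] := star_continuous starP Fs hs' N.
  by exists K => F' F's FF'; apply: HK.
Qed.

Lemma star_seriesr f G r p : smooth X f -> fsmooth X G ->
  star (fconst f) G r p = \sum_(i < r.+1) C (r - i)%N f (G i) p.
Proof.
move=> fs Gs; have fs' := fsmooth_fconst fs.
rewrite (@linear_series _ _ _ X (star (fconst f)))//.
- by apply: eq_bigr => i _; rewrite (star_expansion starP fs (Gs i)).
- by move=> a H H' Hs Hs'; rewrite (star_linearr starP).
- move=> N; have [K HK] := star_continuous starP fs' Gs N.
  by exists K => G' G's GG'; apply: HK.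
Qed.

Lemma smooth_C r f g : smooth X f -> smooth X g -> smooth X (C r f g).
Proof.
move=> fs gs; rewrite -(star_expansion starP fs gs).
exact: (star_smooth starP (fsmooth_fconst fs) (fsmooth_fconst gs)).
Qed.

Lemma C_assoc r f g h p : smooth X f -> smooth X g -> smooth X h ->
  \sum_(i < r.+1) C (r - i)%N (C i f g) h p =
  \sum_(i < r.+1) C (r - i)%N f (C i g h) p.
Proof.
move=> fs gs hs.
have [fs' gs' hs'] := And3 (fsmooth_fconst fs) (fsmooth_fconst gs) (fsmooth_fconst hs).
have := star_assoc starP fs' gs' hs' => /(congr1 (fun F => F r p)).
rewrite (star_seriesl _ _ (star_smooth starP fs' gs') hs).
rewrite (star_seriesr _ _ fs (star_smooth starP gs' hs')).
under eq_bigr do rewrite (star_expansion starP fs gs).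
by under [in RHS]eq_bigr do rewrite (star_expansion starP gs hs).
Qed.

Lemma C_unitr r f : smooth X f -> C r.+1 f (fun=> 1) = fun=> 0.
Proof.
move=> fs; rewrite -(star_expansion starP fs); last exact: smooth_cst.
by rewrite (star_1r starP (fsmooth_fconst fs)).
Qed.

Lemma C_unitl r f : smooth X f -> C r.+1 (fun=> 1) f = fun=> 0.
Proof.
move=> fs; rewrite -(star_expansion starP _ fs); last exact: smooth_cst.
by rewrite (star_1l starP (fsmooth_fconst fs)).
Qed.

Lemma star_separated : separated_associative X true C.
Proof.
split.
- exact: smooth_C.
- exact: sepC.
- by move=> f g fs gs; apply/funext => p; rewrite (star_C0 starP).
- exact: C_unitr.
- by move=> r f g h fs gs hs p; exact: C_assoc.
Qed.

Lemma star_separated_op : separated_associative X false (fun r f g => C r g f).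
Proof.
split.
- by move=> r f g fs gs; exact: smooth_C.
- move=> r phi p aphi dp; have [N [U [c [oU Up UD cs HC]]]] := sepC r aphi dp.
  exists N, U, (fun a b => c b a).
  split=> [||||f g fs gs q Uq]; [exact: oU|exact: Up|exact: UD|by move=> a b; exact: cs|].
  rewrite (HC _ _ gs fs _ Uq) exchange_big /=; apply: eq_bigr => b _; apply: eq_bigr => a _.
  by rewrite mulrAC.
- by move=> f g fs gs; apply/funext => p; rewrite (star_C0 starP)// mulrC.
- exact: C_unitl.
- by move=> r f g h fs gs hs p; rewrite C_assoc.
Qed.

End StarProduct.

Theorem theorem4 (R : realType) (n : nat) (M : topologicalType)
    (X : complexManifold R n M) (eta : kahlerPoisson X)
    (star : (nat -> M -> R[i]) -> (nat -> M -> R[i]) -> (nat -> M -> R[i]))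
    (C : nat -> (M -> R[i]) -> (M -> R[i]) -> (M -> R[i]))
    (hstar : is_star_product eta star C)
    (hsep : separation_of_variables X C) :
  natural X C.
Proof.
have sepl := star_separated hstar hsep.
have sepr := star_separated_op hstar hsep.
move=> r phi p aphi dp; have [N [U [c [oU Up UD cs HC]]]] := hsep r _ _ aphi dp.
pose P (a b : @mindex n N) := antiholomorphic a && holomorphic b.
have c0l a b q : P a b -> (r < mdeg a)%N -> U q -> c a b q = 0.
  by move=> /andP[Pa Pb]; exact: (separated_coef0 sepl aphi UD HC).
have c0r a b q : P a b -> (r < mdeg b)%N -> U q -> c a b q = 0.
  move=> /andP[Pa Pb].
  apply: (separated_coef0 (c := fun a b => c b a) sepr aphi UD _ Pb Pa).
  move=> f g fs gs t Ut; rewrite (HC _ _ gs fs _ Ut) exchange_big /=.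
  by apply: eq_bigr => d _; apply: eq_bigr => d' _; rewrite mulrAC.
(* The same local expression, with the vanishing terms left out. *)
exists N, U, (fun a b => if P a b then c a b else fun=> 0).
split; [exact: oU|exact: Up|exact: UD| |].
  move=> a b; case: ifP => _; [exact: cs|].
  by apply: smooth_on_cst; exact: (open_cmap (cm_chart aphi)).
move=> f g fs gs q Uq; rewrite (HC _ _ fs gs _ Uq).
rewrite big_mkcond [RHS]big_mkcond /=; apply: eq_bigr => a _.
rewrite [X in if _ then X else _]big_mkcond [X in _ = if _ then X else _]big_mkcond /=.
have [Pa|nPa] := boolP (antiholomorphic a); last first.
  case: ifP => // _; rewrite big1// => b _; rewrite /P (negbTE nPa) /=.
  by rewrite !mul0r if_same.
case: leqP => [la|ra]; last first.
  apply: big1 => b _; case: ifP => // Pb.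
  by rewrite c0l ?mul0r// /P Pa.
apply: eq_bigr => b _; case: ifPn => Pb; last first.
  by rewrite /P (negbTE Pb) andbF !mul0r if_same.
rewrite /P Pa Pb /=; case: leqP => // rb.
by rewrite c0r ?mul0r// /P Pa.
Qed.
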